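(* Let $\mathcal{D}$ be a distribution over $\mathbf{I}\times\mathbf{S}$, let $\mathcal{A}$ be a warm start algorithm, let $k\ge1$, $\delta\in(0,1)$, and let $\mathbf{C}^*\in\mathbf{S}^k$ be the set of $k$ centers minimizing $\mathrm{cost}(\mathbf{C},\mathcal{D})$. With access to $m \ge \frac{12 \cdot \mathbf{d}_{\max} \cdot k \cdot \log(1/\delta)}{\mathrm{cost}(\mathbf{C}^*, \mathcal{D})}$ i.i.d. samples from $\mathcal{D}$, it is possible to design an algorithm that has expected runtime $O(k)\cdot \mathrm{cost}(\mathbf{C}^*,\mathcal{D})$ on future instances drawn from $\mathcal{D}$.
   Context: An instance space $\mathbf{I}$ and solution space $\mathbf{S}$ with metric $d$ are given; each instance has a true solution. A warm start algorithm $\mathcal{A}$ takes an instance $I$ and prediction $P\in\mathbf{S}$ and outputs the true solution $S$ of $I$ in time at most $d(P,S)$. Distances are normalized so the minimum distance in $\mathbf{S}$ is $1$ and distances are computable in $O(1)$ time; $\mathbf{d}_{\max}$ is the (finite) width of $\mathbf{S}$. For $\mathbf{C}\in\mathbf{S}^k$, $\mathbf{C}(S)$ is the closest center of $\mathbf{C}$ to $S$, and $\mathrm{cost}(\mathbf{C},\mathcal{D})=\mathbb{E}_{(I,S)\sim\mathcal{D}}[d(\mathbf{C}(S),S)]$.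
   Formalization: The constant in O(k) is uniform over all δ in (0, δ₀] for any fixed δ₀ < 1 but depends on δ₀ (uniformity as δ → 1 fails), the bound holds with probability at least 1 − δ over the samples, and cost(C*, D) > 0 is assumed. *)

(* Defs.v *)
From HB Require Import structures.
From mathcomp Require Import all_boot all_order all_algebra.
From mathcomp Require Import all_classical all_reals all_analysis measurable_realfun.

Set Implicit Arguments.
Unset Strict Implicit.
Unset Printing Implicit Defensive.

Import Order.TTheory GRing.Theory Num.Theory.

Local Open Scope classical_set_scope.
Local Open Scope ring_scope.

(** * Algorithms as step machines *)

Record algorithm (X Y : Type) : Type := Algorithm {
  state : Type;
  init : X -> state;
  step : state -> state;
  result : state -> option Y (* [Some y]: halted with output [y] *)
}.

Definition run X Y (a : algorithm X Y) (x : X) (n : nat) : state a :=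
  iter n (@step _ _ a) (init a x).

(* The first halting configuration is reached after exactly [n] steps and
   carries the output [y]. *)
Definition computes_in X Y (a : algorithm X Y) (x : X) (y : Y) (n : nat) : Prop :=
  result (run a x n) = Some y /\
  forall n', (n' < n)%N -> result (run a x n') = None.

(* [+oo] if [a] never halts on [x]. *)
Definition runtime (R : realType) X Y (a : algorithm X Y) (x : X) : \bar R :=
  ereal_inf [set n%:R%:E | n in [set n | isSome (result (run a x n))]].

(* One step advances exactly one of the [k] runs of [A] (the [t %% k]-th one at
   time [t]), and the machine halts as soon as one of the runs has halted: only
   the run just advanced can have changed status. *)
Definition round_robin I S (A : algorithm (I * S) S) (k : nat) (C : 'I_k -> S) :
    algorithm I S :=
  {| state := nat * ('I_k -> state A);
     init := fun i => (0%N, fun j => init A (i, C j));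
     step := fun s =>
       (s.1.+1, fun j => if nat_of_ord j == (s.1 %% k)%N
                         then step (s.2 j) else s.2 j);
     result := fun s =>
       if [pick j | isSome (result (s.2 j))] is Some j
       then result (s.2 j) else None |}.

(** * Solution spaces *)

Definition is_metric (R : realType) (S : Type) (d : S -> S -> R) : Prop :=
  [/\ forall x y, 0 <= d x y,
      forall x y, d x y = 0 <-> x = y,
      forall x y, d x y = d y x
    & forall x y z, d x z <= d x y + d y z].

Definition min_distance_one (R : realType) (S : Type) (d : S -> S -> R) : Prop :=
  (forall x y, x <> y -> 1 <= d x y) /\ (exists x y, d x y = 1).

Definition distances (R : realType) (S : Type) (d : S -> S -> R) : set R :=
  [set r | exists x y, r = d x y].

Definition finite_width (R : realType) (S : Type) (d : S -> S -> R) : Prop :=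
  has_ubound (distances d).

Definition width (R : realType) (S : Type) (d : S -> S -> R) : R :=
  sup (distances d).

(* [sol i] is the true solution of the instance [i]. *)
Definition warm_start (R : realType) (I S : Type) (d : S -> S -> R)
    (sol : I -> S) (A : algorithm (I * S) S) : Prop :=
  forall i p, exists2 n, computes_in A (i, p) (sol i) n & n%:R <= d p (sol i).

(** * Centers and their cost *)

Definition closest (R : realType) (S : Type) (d : S -> S -> R)
    (k : nat) (k_gt0 : (0 < k)%N) (C : 'I_k -> S) (s : S) : S :=
  C [arg min_(j < Ordinal k_gt0) d (C j) s]%O.

(* The expectation is finite whenever [S] has finite width and the distances to
   fixed points are measurable, so [fine] loses nothing there. *)
Definition cost (R : realType) (dI dS : measure_display)
    (I : measurableType dI) (S : measurableType dS) (d : S -> S -> R)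
    (k : nat) (k_gt0 : (0 < k)%N) (C : 'I_k -> S)
    (D : probability (I * S)%type R) : R :=
  fine ('E_D[fun x : I * S => d (closest d k_gt0 C x.2) x.2]).

(** * Samples *)

Definition mutually_independent (R : realType) (dO dT : measure_display)
    (Omega : measurableType dO) (T : measurableType dT)
    (P : probability Omega R) (m : nat) (X : 'I_m -> {RV P >-> T}) : Prop :=
  forall (J : {set 'I_m}) (B : 'I_m -> set T),
    (forall i, measurable (B i)) ->
    P (\bigcap_(i in [set` J]) (X i @^-1` B i)) =
    (\prod_(i in J) P (X i @^-1` B i))%E.

Definition iid_samples (R : realType) (dO dT : measure_display)
    (Omega : measurableType dO) (T : measurableType dT)
    (P : probability Omega R) (D : probability T R)
    (m : nat) (X : 'I_m -> {RV P >-> T}) : Prop :=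
  mutually_independent X /\
  forall i (B : set T), measurable B -> distribution P (X i) B = D B.

(* Main.v *)
Require Import Defs.
From mathcomp Require Import all_boot all_order all_algebra.
From mathcomp Require Import all_classical all_reals all_analysis measurable_realfun.
From mathcomp Require Import ring lra.

Import Order.TTheory GRing.Theory Num.Theory.

Local Open Scope classical_set_scope.
Local Open Scope ring_scope.

(** The learned centers [C] nearly minimize the empirical cost.  Moving each point
    to its closest optimal center [c_i] gives, up to [cost C*], both
    [cost C ~ \sum_i p_i a_i] and its empirical analogue
    [\sum_i p^_i a_i <= ecost C + ecost C*], where [a_i] is the distance from
    [c_i] to [C].  So no uniform convergence over all centers is needed: it
    suffices that no union of the [k] optimal clusters is badly under-represented
    in the sample (a Chernoff bound and a union bound over [2 ^ k] sets) and that
    the empirical cost of [C*] is not too large (another Chernoff bound).  As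
    distances are [0] or at least [1] and bounded, rounding them makes the
    relevant information on a sample point take finitely many values, and
    independence reduces to finite sums of products.  Running the warm start
    algorithm in parallel from the [k] centers multiplies the runtime from the
    closest one by at most [k]. *)

(** * Interleaved runs of one algorithm: halting, correctness and runtime *)

Section round_robin_theory.
Context {I S : Type} (A : algorithm (I * S) S) {k : nat} (C : 'I_k -> S).

(* The number of [s < t] with [s = j %[mod k]]. *)
Definition turns (j : 'I_k) (t : nat) : nat := ((t + (k.-1 - j)) %/ k)%N.

Lemma turns0 j : turns j 0 = 0%N.
Proof.
rewrite /turns add0n divn_small //.
have k0 : (0 < k)%N by apply: leq_ltn_trans (ltn_ord j).
by rewrite (leq_ltn_trans (leq_subr _ _)) // prednK.
Qed.

(** The quotient grows at time [t] exactly when [k] divides [t + (k - j)], that is when [t] is [j]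
    modulo [k]; the shift [k.-1 - j] in [turns] is chosen for this. *)
Lemma turnsS j t : turns j t.+1 = (turns j t + (nat_of_ord j == t %% k))%N.
Proof.
have jk := ltn_ord j; have k0 : (0 < k)%N by apply: leq_ltn_trans jk.
rewrite /turns addSn divnS // addnC; congr (_ + nat_of_bool _)%N.
have -> : ((t + (k.-1 - j)).+1 = t + (k - j))%N.
  by rewrite -addnS -subSn ?prednK // -ltnS prednK.
rewrite {1}(divn_eq t k) -addnA dvdn_addr ?dvdn_mull //.
have tk := ltn_pmod t k0.
rewrite addnBA 1?ltnW //; apply/dvdnP/eqP => [[q hq]|->]; last first.
  by exists 1%N; rewrite mul1n addKn.
have {}hq : (t %% k + k = q * k + j)%N.
  by rewrite -hq subnK // (leq_trans (ltnW jk)) // leq_addl.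
have := congr1 (modn^~ k) hq.
by rewrite modnDr modn_mod modnMDl [in RHS]modn_small.
Qed.

Lemma turnsM j n : turns j (k * n) = n.
Proof.
have jk := ltn_ord j; have k0 : (0 < k)%N by apply: leq_ltn_trans jk.
rewrite /turns mulnC divnMDl // divn_small ?addn0 //.
by rewrite (leq_ltn_trans (leq_subr _ _)) // prednK.
Qed.

Lemma round_robin_run i t j :
  (run (round_robin A C) i t).1 = t /\
  (run (round_robin A C) i t).2 j = run A (i, C j) (turns j t).
Proof.
elim: t j => [|t IH] j; first by rewrite turns0.
have [E1 E2] := IH j; split; first by rewrite /run iterS /= -/(run _ _ _) E1.
rewrite /run iterS /= -/(run (round_robin A C) i t) E1 E2 turnsS.
by case: ifP => _; rewrite ?addn1 ?addn0.
Qed.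

Lemma round_robin_halted i t :
  isSome (result (run (round_robin A C) i t)) =
  [exists j, isSome (result (run A (i, C j) (turns j t)))].
Proof.
rewrite /=; case: pickP => [j hj|hn].
  rewrite hj; apply/esym/existsP; exists j.
  by rewrite -(round_robin_run i t j).2.
apply/esym/existsP => -[j]; rewrite -(round_robin_run i t j).2.
by rewrite hn.
Qed.

Lemma round_robin_halts_by i j n y : computes_in A (i, C j) y n ->
  isSome (result (run (round_robin A C) i (k * n))).
Proof.
move=> [h _]; rewrite round_robin_halted; apply/existsP; exists j.
by rewrite turnsM h.
Qed.

Lemma runtime_round_robin (R : realType) i j n y : computes_in A (i, C j) y n ->
  (runtime R (round_robin A C) i <= (k * n)%:R%:E)%E.
Proof.
move=> /round_robin_halts_by h; apply: ereal_inf_lbound.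
by exists (k * n)%N.
Qed.

(* Before the first halting time no run has passed its own halting time, so the
   run that stops the machine stops exactly at its own first halting
   configuration. *)
Lemma round_robin_computes i y : (0 < k)%N ->
  (forall j, exists n, computes_in A (i, C j) y n) ->
  exists n, computes_in (round_robin A C) i y n.
Proof.
move=> k0 hA.
have ex : exists n, isSome (result (run (round_robin A C) i n)).
  have [n hn] := hA (Ordinal k0); exists (k * n)%N.
  exact: round_robin_halts_by hn.
case: (ex_minnP ex) => T hT minT.
have bef t : (t < T)%N -> result (run (round_robin A C) i t) = None.
  move=> tT; case E : (result _) => [z|//].
  by have := minT t; rewrite E leqNgt tT => /(_ isT).
exists T; split=> //.
have inv t : (t <= T)%N -> forall j n, computes_in A (i, C j) y n ->
    (turns j t <= n)%N.
  elim: t => [|t IH] tT j n hn; first by rewrite turns0.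
  have := IH (ltnW tT) j n hn; rewrite leq_eqVlt => /orP[/eqP e|lt].
    have := round_robin_halted i t; rewrite bef //= => /esym/existsP[].
    by exists j; rewrite e hn.1.
  by rewrite turnsS (leq_trans _ lt) // -addn1 leq_add2l leq_b1.
move: hT; rewrite /=; case: pickP => [j hj|//] _.
move: hj; rewrite (round_robin_run i T j).2 => hj.
have [n hn] := hA j; have := inv _ (leqnn T) j n hn.
rewrite leq_eqVlt => /orP[/eqP ->|lt]; first exact: hn.1.
by move: hj; rewrite hn.2.
Qed.

End round_robin_theory.

(** * Product weights on finite samples and their exponential tails *)

Section product_weights.
Context {R : realType} {F : finType} (q : F -> R) (m : nat).

(** For a probability [q], the law of [m] independent draws. General weights are allowed because
    [wgt_tail] also uses [q] tilted by [expR (f x)]. *)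
Definition wgt (v : {ffun 'I_m -> F}) : R := \prod_j q (v j).

Lemma wgt_ge0 v : (forall x, 0 <= q x) -> 0 <= wgt v.
Proof. by move=> q0; apply: prodr_ge0. Qed.

Lemma sum_wgt : \sum_v wgt v = (\sum_x q x) ^+ m.
Proof.
rewrite /wgt -(bigA_distr_bigA (fun _ => q)).
by rewrite prodr_const card_ord.
Qed.

End product_weights.

(** Chernoff's method: on the event, [expR (\sum_j f (v j) - b)] is at least [1], and the
    exponential moment factors over the draws by [sum_wgt] for the tilted weights. *)
Lemma wgt_tail {R : realType} {F : finType} (q : F -> R) (m : nat)
    (f : F -> R) (b : R) : (forall x, 0 <= q x) ->
  \sum_(v : {ffun 'I_m -> F} | b <= \sum_j f (v j)) wgt q m v <=
  (\sum_x q x * expR (f x)) ^+ m * expR (- b).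
Proof.
move=> q0; rewrite -sum_wgt mulr_suml big_mkcond /=; apply: ler_sum => v _.
have -> : wgt (fun x => q x * expR (f x)) m v =
    wgt q m v * expR (\sum_j f (v j)).
  by rewrite expR_sum -big_split.
have w0 : 0 <= wgt q m v by exact: wgt_ge0.
case: ifPn => hb; last by rewrite !mulr_ge0 ?expR_ge0.
rewrite -mulrA -expRD ler_peMr //.
by apply: le_trans (expR_ge1Dx _); rewrite lerDl subr_ge0.
Qed.

(** The bound [1 - x <= expR (- x)] gives [expR x * (1 - x) <= 1], while
    [(1 + 2 * x) * (1 - x) >= 1] on this interval. *)
Lemma expR_le1D2x {R : realType} (x : R) : 0 <= x <= 2^-1 ->
  expR x <= 1 + 2 * x.
Proof.
move=> /andP[x0 x2].
have e0 : 0 < expR x by exact: expR_gt0.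
have : 1 - x <= (expR x)^-1 by rewrite -expRN; exact: expR_ge1Dx.
rewrite -(ler_pM2l e0) divff ?gt_eqF // => h; nra.
Qed.

Lemma expRN1_le {R : realType} : expR (- 1) <= 2^-1 :> R.
Proof.
rewrite expRN lef_pV2 ?posrE ?expR_gt0 //.
by apply: le_trans (expR_ge1Dx _).
Qed.

(** * Chernoff bounds for cluster masses and for the empirical cost *)

Section concentration.
Context {R : realType} {F : finType} {k m : nat}.
Variables (q : F -> R) (c : F -> 'I_k) (g : F -> R) (M opt kappa : R).

Definition mass (J : {set 'I_k}) : R := \sum_x q x * (c x \in J)%:R.

Definition hits (v : {ffun 'I_m -> F}) (J : {set 'I_k}) : R :=
  \sum_j (c (v j) \in J)%:R.

(** The slack in the second condition carries a division by [M] because [typical_sum] multiplies it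
    by [M], the largest possible distance; it then becomes comparable to [m%:R * opt]. *)
Definition typical (v : {ffun 'I_m -> F}) : bool :=
  (\sum_j g (v j) < (2 + kappa) * (m%:R * opt)) &&
  [forall J : {set 'I_k},
    m%:R * mass J - 2 * hits v J < kappa * (m%:R * opt / M)].

Hypotheses (q0 : forall x, 0 <= q x) (q1 : \sum_x q x = 1) (M0 : 0 < M).

(** The deficits [e i] of the clusters, weighted by [a i], sum to at most [M] times the positive
    deficits. These add up to the deficit of a single union of clusters, which [typical]
    controls. *)
Lemma typical_sum (v : {ffun 'I_m -> F}) (a : 'I_k -> R) :
  typical v -> (forall i, 0 <= a i <= M) ->
  m%:R * (\sum_x q x * a (c x)) <=
  2 * (\sum_j a (c (v j))) + kappa * (m%:R * opt).
Proof.
move=> /andP[_ /forallP hJ] ha.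
(* Regrouping by cluster, used with weights [q] on labels and with unit weights on sample
   indices. *)
have sumE (T : finType) (e : T -> 'I_k) (r : T -> R) (b : 'I_k -> R) :
    \sum_x r x * b (e x) = \sum_i b i * (\sum_x r x * (e x == i)%:R).
  under [RHS]eq_bigr do rewrite mulr_sumr.
  rewrite exchange_big; apply: eq_bigr => x _.
  rewrite (bigD1 (e x)) //= eqxx mulr1 big1 ?addr0 1?mulrC // => i.
  by rewrite eq_sym => /negbTE ->; rewrite !mulr0.
have sumE1 (b : 'I_k -> R) : \sum_j b (c (v j)) = \sum_i b i * (\sum_j (c (v j) == i)%:R).
  have := sumE _ (fun j => c (v j)) (fun=> 1) b.
  under eq_bigr do rewrite mul1r.
  by under [in RHS]eq_bigr do under eq_bigr do rewrite mul1r.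
pose e i := m%:R * (\sum_x q x * (c x == i)%:R) - 2 * (\sum_j (c (v j) == i)%:R).
have eE (b : 'I_k -> R) : m%:R * (\sum_x q x * b (c x)) - 2 * (\sum_j b (c (v j))) =
    \sum_i b i * e i.
  rewrite sumE sumE1 !mulr_sumr -sumrB; apply: eq_bigr => i _.
  rewrite /e; ring.
rewrite addrC -lerBlDr eE.
pose J : {set 'I_k} := [set i | 0 < e i]%SET.
apply: (@le_trans _ _ (\sum_i M * ((i \in J)%:R * e i))).
  apply: ler_sum => i _; rewrite inE; have /andP[a0 aM] := ha i.
  case: ltP => h; first by rewrite mul1r ler_wpM2r // ltW.
  by rewrite mul0r mulr0 mulr_ge0_le0.
rewrite -mulr_sumr -(eE (fun i => (i \in J)%:R)) -ler_pdivlMl //.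
apply: le_trans (ltW (hJ J)) _.
by rewrite le_eqVlt; apply/orP; left; apply/eqP; field; exact: lt0r_neq0.
Qed.

Variables (L L0 : R).
Hypotheses (g0M : forall x, 0 <= g x <= M) (gopt : \sum_x q x * g x <= opt)
  (opt0 : 0 < opt) (L00 : 0 < L0) (L0L : L0 <= L) (k0 : (0 < k)%N)
  (hm : 12 * k%:R * L <= m%:R * opt / M) (hkappa : kappa = 1 + L0^-1).

(** As [L0 <= L], the summand [L0^-1] of [kappa] contributes at least [1], however small [L] is. *)
Let kL : L + 1 <= kappa * L.
Proof.
rewrite hkappa mulrDl mul1r lerD2l.
by rewrite -(ler_pM2l L00) mulrA divff ?gt_eqF // mulr1 mul1r.
Qed.

(** The term [k%:R] pays for the union bound over [2 ^ k] sets, and the [- 1] leaves at most half of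
    [expR (- L)] to each of the two kinds of failure. *)
Let expB : k%:R + - (kappa * (m%:R * opt / M) / 2) <= - L - 1.
Proof.
have k1 : 1 <= k%:R :> R by rewrite ler1n.
have kap0 : 0 < kappa by rewrite hkappa addr_gt0 // invr_gt0.
have : kappa * (12 * k%:R * L) <= kappa * (m%:R * opt / M).
  by rewrite ler_pM2l.
have : k%:R * (L + 1) <= k%:R * (kappa * L) by rewrite ler_pM2l // ltr0n.
have L10 : 0 < L + 1 by rewrite addr_gt0 // (lt_le_trans L00).
have : 1 * (L + 1) <= k%:R * (L + 1) by rewrite ler_pM2r.
have : 0 < k%:R * L by rewrite mulr_gt0 ?ltr0n // (lt_le_trans L00).
lra.
Qed.

Lemma cost_tail :
  \sum_(v : {ffun 'I_m -> F} | (2 + kappa) * (m%:R * opt) <= \sum_j g (v j))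
     wgt q m v <= expR (- L - 1).
Proof.
have k1 : 1 <= k%:R :> R by rewrite ler1n.
(* Dividing by [2 * M] brings the exponents into the range of [expR_le1D2x]; the moment is then at
   most [1 + opt / M]. *)
pose f x := g x / (2 * M); pose b := (1 + kappa / 2) * (m%:R * opt / M).
have M20 : 0 < 2 * M by rewrite mulr_gt0.
rewrite (eq_bigl (fun v : {ffun 'I_m -> F} => b <= \sum_j f (v j))); last first.
  move=> v; rewrite /f -mulr_suml ler_pdivlMr // /b.
  by congr (_ <= _); field; exact: lt0r_neq0.
apply: le_trans (wgt_tail _ _ f b q0) _.
have h : \sum_x q x * expR (f x) <= expR (opt / M).
  apply: le_trans (expR_ge1Dx _).
  apply: (@le_trans _ _ (\sum_x (q x + q x * g x / M))).
    apply: ler_sum => x _.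
    have -> : q x + q x * g x / M = q x * (1 + 2 * f x).
      by rewrite /f; field; exact: lt0r_neq0.
    rewrite ler_wpM2l //; apply: expR_le1D2x; rewrite /f.
    have /andP[h1 h2] := g0M x.
    rewrite divr_ge0 ?(ltW M20) //= ler_pdivrMr //; lra.
  by rewrite big_split /= q1 lerD2l -mulr_suml ler_pM2r // invr_gt0.
apply: (@le_trans _ _ (expR (opt / M) ^+ m * expR (- b))).
  rewrite ler_wpM2r ?expR_ge0 // lerXn2r // nnegrE ?expR_ge0 //.
  by apply: sumr_ge0 => x _; rewrite mulr_ge0 ?expR_ge0.
rewrite -expRM_natl -expRD ler_expR; apply: le_trans expB; rewrite /b; lra.
Qed.

(** With tilt [-1] on the indicator, [expR (- 1) <= 2^-1] bounds the moment by [1 - mass J / 2]. The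
    factor [2] on [hits] makes [mass J] cancel, so the bound is the same for every [J]. *)
Lemma mass_tail (J : {set 'I_k}) :
  \sum_(v : {ffun 'I_m -> F} |
      kappa * (m%:R * opt / M) <= m%:R * mass J - 2 * hits v J)
     wgt q m v <= expR (- (kappa * (m%:R * opt / M) / 2)).
Proof.
set u := m%:R * opt / M.
pose f x : R := - (c x \in J)%:R; pose b := (kappa * u - m%:R * mass J) / 2.
rewrite (eq_bigl (fun v : {ffun 'I_m -> F} => b <= \sum_j f (v j))); last first.
  move=> v; rewrite /f sumrN -/(hits v J) /b.
  by apply/idP/idP => ?; lra.
apply: le_trans (wgt_tail _ _ f b q0) _.
have h : \sum_x q x * expR (f x) <= expR (- (mass J / 2)).
  apply: le_trans (expR_ge1Dx _).
  rewrite -[X in _ <= X - _]q1 /mass mulr_suml -sumrB; apply: ler_sum => x _.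
  rewrite -mulrA -[X in X - _]mulr1 -mulrBr ler_wpM2l // /f.
  case: (c x \in J); last by rewrite oppr0 expR0 mul0r subr0.
  apply: le_trans expRN1_le _; rewrite mul1r; lra.
apply: (@le_trans _ _ (expR (- (mass J / 2)) ^+ m * expR (- b))).
  rewrite ler_wpM2r ?expR_ge0 // lerXn2r // nnegrE ?expR_ge0 //.
  by apply: sumr_ge0 => x _; rewrite mulr_ge0 ?expR_ge0.
rewrite -expRM_natl -expRD ler_expR /b; lra.
Qed.

Lemma typical_wgt :
  1 - expR (- L) <= \sum_(v : {ffun 'I_m -> F} | typical v) wgt q m v.
Proof.
have w0 v : 0 <= wgt q m v by exact: wgt_ge0.
have := sum_wgt q m; rewrite q1 expr1n (bigID typical) /= => E.
suff : \sum_(v : {ffun 'I_m -> F} | ~~ typical v) wgt q m v <= expR (- L).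
  by lra.
pose B (J : {set 'I_k}) (v : {ffun 'I_m -> F}) :=
  kappa * (m%:R * opt / M) <= m%:R * mass J - 2 * hits v J.
pose B0 (v : {ffun 'I_m -> F}) := (2 + kappa) * (m%:R * opt) <= \sum_j g (v j).
apply: (@le_trans _ _ (\sum_(v | B0 v) wgt q m v +
    \sum_J \sum_(v | B J v) wgt q m v)).
  under [X in _ <= _ + X]eq_bigr do rewrite big_mkcond.
  rewrite exchange_big /= big_mkcond [X in _ <= X + _]big_mkcond -big_split /=.
  apply: ler_sum => v _; have s0 : 0 <= \sum_J (if B J v then wgt q m v else 0).
    by apply: sumr_ge0 => J _; case: ifP.
  case: ifP => [|_]; last by rewrite addr_ge0 //; case: ifP.
  rewrite negb_and -leNgt -/(B0 v) => /orP[->|]; first by rewrite lerDl.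
  rewrite negb_forall => /existsP[J]; rewrite -leNgt => BJ.
  apply: (@le_trans _ _ (\sum_J (if B J v then wgt q m v else 0))).
    rewrite (bigD1 J) //= {1}/B BJ lerDl.
    by apply: sumr_ge0 => i _; case: ifP.
  by rewrite lerDr; case: ifP.
have e2 : 2 * expR (- L - 1) <= expR (- L).
  have := @expRN1_le R; rewrite expRD -(ler_pM2l (expR_gt0 (- L))); lra.
apply: le_trans e2; rewrite mulrC mulr_natr mulr2n lerD //; first exact: cost_tail.
apply: le_trans; first by apply: ler_sum => J _; exact: mass_tail.
(* The number of sets is [2 ^ k], which is at most [expR k%:R], the form that [expB] expects. *)
rewrite sumr_const -cardsT -powersetT card_powerset cardsT card_ord.
rewrite -[leLHS]mulr_natl; apply: (@le_trans _ _ (expR k%:R *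
    expR (- (kappa * (m%:R * opt / M) / 2)))); last first.
  by rewrite -expRD ler_expR; exact: expB.
rewrite ler_wpM2r ?expR_ge0 // natrX -[k%:R]mulr1 expRM_natl.
rewrite lerXn2r ?nnegrE ?expR_ge0 //.
by apply: le_trans (expR_ge1Dx _).
Qed.

End concentration.

(** * Laws of finite-valued labels of i.i.d. samples *)

Section finite_labels.
Context {R : realType} {dT : measure_display} {T : measurableType dT}.
Variables (D : probability T R) (F : finType) (phi : T -> F).
Hypothesis mphi : forall x, measurable (phi @^-1` [set x]).

Definition label_mass (x : F) : R := fine (D (phi @^-1` [set x])).

Lemma label_massE x : D (phi @^-1` [set x]) = (label_mass x)%:E.
Proof. by rewrite fineK // fin_num_measure. Qed.

Lemma label_mass_ge0 x : 0 <= label_mass x.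
Proof. exact: fine_ge0. Qed.

Lemma label_funE (b : F -> R) t :
  b (phi t) = \sum_x b x * \1_(phi @^-1` [set x]) t.
Proof.
rewrite (bigD1 (phi t)) //= indicE mem_set // mulr1 big1 ?addr0 //.
move=> x /eqP xt; rewrite indicE memNset ?mulr0 //.
by move=> h; apply: xt; rewrite -h.
Qed.

Lemma measurable_label_fun (b : F -> R) :
  measurable_fun setT (fun t => b (phi t)).
Proof.
under eq_fun do rewrite label_funE; apply: measurable_sum => x.
by apply: measurable_funM => //; exact: measurable_indic.
Qed.

Lemma label_mass_integral (b : F -> R) : (forall x, 0 <= b x) ->
  (\int[D]_t (b (phi t))%:E = (\sum_x label_mass x * b x)%:E)%E.
Proof.
move=> b0.
have E t : (b (phi t))%:E =
    (\sum_x (b x)%:E * (\1_(phi @^-1` [set x]) t)%:E)%E.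
  by rewrite label_funE -sumEFin; apply: eq_bigr => x _; rewrite EFinM.
under eq_integral do rewrite E.
rewrite ge0_integral_sum //; last 2 first.
- move=> x; apply: measurable_funeM; apply/measurable_EFinP.
  exact: measurable_indic.
- by move=> x t _; rewrite mule_ge0 ?lee_fin.
rewrite -sumEFin; apply: eq_bigr => x _.
rewrite ge0_integralZl_EFin //; last first.
  by apply/measurable_EFinP; exact: measurable_indic.
by rewrite integral_indic // setIT [X in (_ * X)%E]label_massE -EFinM mulrC.
Qed.

Lemma label_mass_sum1 : \sum_x label_mass x = 1.
Proof.
apply: EFin_inj; have := label_mass_integral (fun=> 1) (fun=> ler01).
under eq_bigr do rewrite mulr1.
by move=> <-; rewrite integral_cst // mul1e; exact: probability_setT.
Qed.

Context {dO : measure_display} {Omega : measurableType dO}.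
Variables (P : probability Omega R) (m : nat) (X : 'I_m -> {RV P >-> T}).
Hypothesis iidX : iid_samples D X.

Let cell (v : {ffun 'I_m -> F}) : set Omega :=
  \bigcap_(j in [set` [set: 'I_m]%SET]) (X j @^-1` (phi @^-1` [set v j])).

Let cellP v w : cell v w <-> [ffun j => phi (X j w)] = v.
Proof.
split=> [h|<- j _]; last by rewrite /= ffunE.
by apply/ffunP => j; rewrite ffunE; apply: h; rewrite /= finset.in_setT.
Qed.

Let mcell v : measurable (cell v).
Proof.
apply: fin_bigcap_measurable; first exact: finite_finset.
by move=> j _; rewrite -[X in measurable X]setTI; exact: measurable_funPT.
Qed.

Let cell_prob v : P (cell v) = (wgt label_mass m v)%:E.
Proof.
rewrite /cell iidX.1; last by [].
rewrite /wgt -prodEFin; apply: eq_big => [j|j _]; first by rewrite finset.in_setT.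
by rewrite -label_massE -(iidX.2 j).
Qed.

Let eventE (Q : pred {ffun 'I_m -> F}) :
  [set w | Q [ffun j => phi (X j w)]] = \bigcup_(v in [set` enum Q]) cell v.
Proof.
apply/seteqP; split=> w /=.
  by move=> Qw; exists [ffun j => phi (X j w)]; [rewrite /= mem_enum|apply/cellP].
by move=> [v /=]; rewrite mem_enum => Qv /cellP ->.
Qed.

Lemma measurable_label_event (Q : pred {ffun 'I_m -> F}) :
  measurable [set w | Q [ffun j => phi (X j w)]].
Proof. by rewrite eventE; apply: fin_bigcup_measurable. Qed.

(** The event is a finite disjoint union of cells, one per label vector, and independence turns the
    probability of each cell into a product. *)
Lemma label_event_prob (Q : pred {ffun 'I_m -> F}) :
  P [set w | Q [ffun j => phi (X j w)]] =
  (\sum_(v | Q v) wgt label_mass m v)%:E.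
Proof.
rewrite eventE measure_fin_bigcup //; last first.
  by move=> v v' _ _ [w [/cellP <- /cellP <-]].
rewrite -fsbig_seq ?enum_uniq // big_enum -sumEFin.
by apply: eq_bigr => v _; exact: cell_prob.
Qed.

End finite_labels.

(** * Closest centers: triangle inequality and measurability *)

Section centers.
Context {R : realType} {dS : measure_display} {S : measurableType dS}.
Variables (d : S -> S -> R) (k : nat) (k_gt0 : (0 < k)%N).
Hypothesis metric_d : is_metric d.
Hypothesis width_d : finite_width d.
Hypothesis md : forall p, measurable_fun setT (d p).
Implicit Type C : 'I_k -> S.

Lemma dist_le_width x y : d x y <= width d.
Proof. by apply: ub_le_sup => //; exists x, y. Qed.

Lemma closest_le C s j : d (closest d k_gt0 C s) s <= d (C j) s.
Proof. by rewrite /closest; case: arg_minP => // i _; apply. Qed.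

Lemma closest_mem C s : exists j, closest d k_gt0 C s = C j.
Proof. by eexists; reflexivity. Qed.

Lemma closest_le_add C s t :
  d (closest d k_gt0 C t) t <= d (closest d k_gt0 C s) s + d s t.
Proof.
have [j ej] := closest_mem C s; rewrite ej.
have [_ _ _ tri] := metric_d.
exact: le_trans (closest_le C t j) (tri _ _ _).
Qed.

Lemma measurable_closest C :
  measurable_fun setT (fun s => d (closest d k_gt0 C s) s).
Proof.
(* The initial value of the iterated minimum is itself one of the distances, so it does not change
   the minimum. *)
have E : (fun s => d (closest d k_gt0 C s) s) =
    (fun s => \big[Order.min/d (C (Ordinal k_gt0)) s]_(j <- enum 'I_k) d (C j) s).
  apply/funext => s; apply/eqP; rewrite eq_le; apply/andP; split.
    by apply: le_bigmin => [|j _]; exact: closest_le.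
  by have [j ->] := closest_mem C s; rewrite big_enum; exact: bigmin_le.
rewrite E; elim: (enum _) => [|j r IH].
  by under eq_fun do rewrite big_nil; exact: md.
under eq_fun do rewrite big_cons.
exact: measurable_minr.
Qed.

(* Breaking ties by the smallest index makes the fibres explicit measurable
   sets. *)
Definition nearest C s : 'I_k :=
  [arg min_(i < [arg min_(j < Ordinal k_gt0) d (C j) s]%O
           | [forall j, (d (C i) s <= d (C j) s)%R]) (i : nat)]%N.

Lemma nearestP C s i : nearest C s = i <->
  (forall j, d (C i) s <= d (C j) s) /\
  (forall i' : 'I_k, (i' < i)%N -> ~ forall j, d (C i') s <= d (C j) s).
Proof.
rewrite /nearest; case: arg_minnP => [|l /forallP hl minl].
  by apply/forallP => j; case: Order.TotalTheory.arg_minP => // l _; apply.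
split=> [<-|[hi mini]].
  split=> // i' lt h; have /minl : [forall j, d (C i') s <= d (C j) s].
    by apply/forallP.
  by rewrite leqNgt lt.
apply/val_inj/eqP; rewrite eqn_leq minl /=; last exact/forallP.
by rewrite leqNgt; apply/negP => /mini; apply.
Qed.

Lemma dist_nearest C s : d (C (nearest C s)) s = d (closest d k_gt0 C s) s.
Proof.
apply/eqP; rewrite eq_le closest_le andbT.
have [h _] := (nearestP C s _).1 erefl.
by have [j ->] := closest_mem C s.
Qed.

Lemma measurable_nearest C i : measurable (nearest C @^-1` [set i]).
Proof.
pose V i := [set s | forall j, d (C i) s <= d (C j) s].
have mV l : measurable (V l).
  have -> : V l = \bigcap_(j in [set: 'I_k]) [set s | d (C l) s <= d (C j) s].
    by apply/seteqP; split => s h j; [move=> _; exact: h|exact: (h j Logic.I)].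
  apply: fin_bigcap_measurable => // j _.
  by rewrite -[X in measurable X]setTI; exact: measurable_fun_le.
have -> : nearest C @^-1` [set i] =
    V i `&` \bigcap_(i' in [set i' : 'I_k | (i' < i)%N]) ~` V i'.
  by apply/seteqP; split=> s /nearestP.
apply: measurableI => //; apply: fin_bigcap_measurable; first exact: finite_finset.
by move=> l _; exact: measurableC.
Qed.

End centers.

(** * The cost as a finite integral *)

Section cost_theory.
Context {R : realType} {dI dS : measure_display}.
Context {I : measurableType dI} {S : measurableType dS}.
Variables (d : S -> S -> R) (k : nat) (k_gt0 : (0 < k)%N).
Hypothesis metric_d : is_metric d.
Hypothesis width_d : finite_width d.
Hypothesis md : forall p, measurable_fun setT (d p).
Variable D : probability (I * S)%type R.

Lemma measurable_closest_snd (C : 'I_k -> S) :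
  measurable_fun setT (fun x : I * S => d (closest d k_gt0 C x.2) x.2).
Proof.
apply: (@measurableT_comp _ _ _ _ _ _
  (fun s => d (closest d k_gt0 C s) s) _ snd) => //.
exact: measurable_closest.
Qed.

Lemma costE (C : 'I_k -> S) : (cost d k_gt0 C D)%:E =
  (\int[D]_x (d (closest d k_gt0 C x.2) x.2)%:E)%E.
Proof.
have [d0 _ _ _] := metric_d.
rewrite /cost unlock fineK // fin_numElt; apply/andP; split.
  by apply: (@lt_le_trans _ _ 0%E) => //; apply: integral_ge0 => x _; rewrite lee_fin.
apply: (@le_lt_trans _ _ (\int[D]_x (width d)%:E)%E).
  apply: ge0_le_integral => //.
  - by move=> x _; rewrite lee_fin.
  - by apply/measurable_EFinP; exact: measurable_closest_snd.
  - by move=> x _; rewrite lee_fin dist_le_width.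
rewrite integral_cst // [X in (_ * X)%E](@probability_setT _ _ _ D) mule1.
exact: ltry.
Qed.

End cost_theory.

(** The infimum of the empirical cost may not be attained. The additive slack [1] is absorbed in
    [typical_cost]. *)
Lemma near_minimizer {R : realType} {T : Type} (e : T -> R) (t0 : T) :
  (forall t, 0 <= e t) -> exists t, forall t', e t <= e t' + 1.
Proof.
move=> e0; have hinf : has_inf (range e).
  by split; [exists (e t0), t0|exists 0 => _ [t _ <-]].
have [_ [t _ <-] lt] := inf_adherent ltr01 hinf.
exists t => t'; apply: (le_trans (ltW lt)); rewrite lerD2r.
by apply: ge_inf; [exact: hinf.2|exists t'].
Qed.

(** The integral of a nonnegative function is a supremum over the simple functions below it, and
    this family only grows from [f] to [g]. *)
Lemma ge0_le_integral_nonmeasurable {R : realType} {dT : measure_display}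
    {T : measurableType dT} (mu : {measure set T -> \bar R}) (f g : T -> \bar R) :
  (forall x, 0 <= f x)%E -> (forall x, f x <= g x)%E ->
  (\int[mu]_x f x <= \int[mu]_x g x)%E.
Proof.
move=> f0 fg; have g0 x : (0 <= g x)%E by apply: le_trans (fg x).
rewrite !ge0_integralTE //; apply: le_ereal_sup => _ [h hf <-].
by exists h => // x; apply: le_trans (hf x) (fg x).
Qed.

(** * Expected runtime of the parallel machine in terms of the cost *)

Section expected_runtime.
Context {R : realType} {dI dS : measure_display}.
Context {I : measurableType dI} {S : measurableType dS}.
Variables (d : S -> S -> R) (sol : I -> S) (A : algorithm (I * S) S).
Variables (k : nat) (k_gt0 : (0 < k)%N).
Hypothesis metric_d : is_metric d.
Hypothesis width_d : finite_width d.
Hypothesis md : forall p, measurable_fun setT (d p).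
Hypothesis warm : warm_start d sol A.

Lemma runtime_ge0 X Y (a : algorithm X Y) (x : X) : (0 <= runtime R a x)%E.
Proof. by apply: le_ereal_inf_tmp => _ [n _ <-]; rewrite lee_fin. Qed.

Lemma runtime_round_robin_le (C : 'I_k -> S) i :
  (runtime R (round_robin A C) i <=
   (k%:R * d (closest d k_gt0 C (sol i)) (sol i))%:E)%E.
Proof.
have [j ->] := closest_mem d k k_gt0 C (sol i).
have [n hn nd] := warm i (C j).
apply: (le_trans (runtime_round_robin _ _ R _ j n _ hn)).
by rewrite lee_fin natrM ler_wpM2l.
Qed.

(* [sol] is not assumed measurable, so the almost sure bound in terms of [x.2]
   is first made to hold everywhere by adding [+oo] on a null set. *)
Lemma expected_runtime_le (D : probability (I * S)%type R) (C : 'I_k -> S) :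
  {ae D, forall x, x.2 = sol x.1} ->
  (\int[D]_x runtime R (round_robin A C) x.1 <=
   (k%:R * cost d k_gt0 C D)%:E)%E.
Proof.
have [d0 _ _ _] := metric_d.
move=> [N [mN N0 subN]].
pose f (x : I * S) := d (closest d k_gt0 C x.2) x.2.
have mf : measurable_fun setT (fun x : I * S => (f x)%:E).
  by apply/measurable_EFinP; exact: measurable_closest_snd.
have mN1 : measurable_fun setT (fun x : I * S => (\1_N x)%:E : \bar R).
  by apply/measurable_EFinP; exact: measurable_indic.
pose g (x : I * S) := (k%:R%:E * (f x)%:E + +oo * (\1_N x)%:E)%E.
apply: (@le_trans _ _ (\int[D]_x g x)%E).
  apply: ge0_le_integral_nonmeasurable => [x|x]; first exact: runtime_ge0.
  rewrite /g indicE; have [xN|xN] := boolP (x \in N).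
    by rewrite mule1 addey ?leey // -EFinM.
  have e : x.2 = sol x.1.
    by apply: contrapT => h; move/negP: xN; apply; apply/mem_set/subN.
  rewrite mule0 adde0 -EFinM /f e.
  exact: runtime_round_robin_le.
rewrite ge0_integralD //; last 3 first.
- by move=> x _; rewrite -EFinM lee_fin mulr_ge0 //; exact: d0.
- exact: measurable_funeM.
- exact: measurable_funeM.
rewrite ge0_integralZl_EFin //; last by move=> x _; rewrite lee_fin; exact: d0.
rewrite ge0_integralZl // integral_indic // setIT.
(* By convention [+oo * 0] is [0], so the null set contributes nothing. *)
rewrite [X in (_ + +oo * X)%E](_ : _ = 0%E) // mule0 adde0.
by rewrite EFinM (costE d k k_gt0).
Qed.

End expected_runtime.

(** * From a typical sample to the true cost of the learned centers *)

Section learning.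
Context {R : realType} {dI dS : measure_display}.
Context {I : measurableType dI} {S : measurableType dS}.
Variables (d : S -> S -> R) (k : nat) (k_gt0 : (0 < k)%N).
Hypothesis metric_d : is_metric d.
Hypothesis min1 : min_distance_one d.
Hypothesis width_d : finite_width d.
Hypothesis md : forall p, measurable_fun setT (d p).
Variable Cstar : 'I_k -> S.

Let rad (C : 'I_k -> S) s := d (closest d k_gt0 C s) s.
Let N := Num.truncn (width d).

(* Distances being [0] or at least [1], truncating them to integers loses at
   most a factor [2] and leaves finitely many labels. *)
Definition sample_label (x : I * S) : 'I_k * 'I_N.+1 :=
  (nearest d k k_gt0 Cstar x.2, inord (Num.truncn (rad Cstar x.2))).

Let rad_ge0 C s : 0 <= rad C s.
Proof. by have [d0 _ _ _] := metric_d; exact: d0. Qed.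

Lemma width_ge1 : 1 <= width d.
Proof. by have [_ [x [y <-]]] := min1; exact: dist_le_width. Qed.

Lemma sample_label_val x :
  nat_of_ord (sample_label x).2 = Num.truncn (rad Cstar x.2).
Proof. by rewrite /= inordK // ltnS le_truncn // dist_le_width. Qed.

(** A nonzero distance [r] has integer part [t >= 1], hence [r < t + 1 <= 2 * t]. *)
Lemma rad_le_label x : rad Cstar x.2 <= 2 * (sample_label x).2%:R.
Proof.
rewrite sample_label_val.
have /andP[h1 h2] := truncn_itv (rad_ge0 Cstar x.2).
have [_ d00 _ _] := metric_d; have [m1 _] := min1.
have [e|ne] := pselect (closest d k_gt0 Cstar x.2 = x.2).
  by rewrite {1}/rad e (d00 _ _).2 // mulr_ge0.
have r1 : 1 <= rad Cstar x.2 by exact: m1.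
have t1 : (0 < Num.truncn (rad Cstar x.2))%N by rewrite truncn_gt0.
have : 1 <= (Num.truncn (rad Cstar x.2))%:R :> R by rewrite ler1n.
by move: h2; rewrite -natr1; lra.
Qed.

Lemma label_le_rad x : (sample_label x).2%:R <= rad Cstar x.2.
Proof. by rewrite sample_label_val truncn_le. Qed.

Lemma measurable_sample_label l : measurable (sample_label @^-1` [set l]).
Proof.
have -> : sample_label @^-1` [set l] =
    setT `&` snd @^-1` (nearest d k k_gt0 Cstar @^-1` [set l.1] `&`
      (setT `&` rad Cstar @^-1` `[l.2%:R, l.2.+1%:R[)).
  rewrite !setTI; apply/seteqP; split=> x /=.
    move=> <-; split=> //; rewrite in_itv /=.
    by rewrite -[inord _]/(sample_label x).2 sample_label_val truncn_itv.
  rewrite in_itv /= => -[e1 e2]; rewrite (surjective_pairing l); congr (_, _) => //.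
  apply/ord_inj/eqP; rewrite -[inord _]/(sample_label x).2 sample_label_val.
  by rewrite truncn_eq.
apply: measurable_snd => //; apply: measurableI; first exact: measurable_nearest.
exact: measurable_closest.
Qed.

Variable D : probability (I * S)%type R.
Variable m : nat.
Variables (kappa L L0 : R).

Let opt := cost d k_gt0 Cstar D.
Let q := label_mass D _ sample_label.
Let typ := typical q fst (fun l => l.2%:R) (width d) opt kappa (m := m).

Hypothesis opt0 : 0 < opt.
Hypothesis L00 : 0 < L0.
Hypothesis L0L : L0 <= L.
Hypothesis hm : 12 * k%:R * L <= m%:R * opt / width d.
Hypothesis hkappa : kappa = 1 + L0^-1.

Lemma sample_typical_prob :
  1 - expR (- L) <= \sum_(v : {ffun 'I_m -> _} | typ v) wgt q m v.
Proof.
have W1 := width_ge1.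
apply: (typical_wgt q fst _ (width d) opt kappa _ _ _ L L0) => //.
- by move=> x; exact: label_mass_ge0.
- by apply: label_mass_sum1; exact: measurable_sample_label.
- exact: lt_le_trans W1.
- move=> l; rewrite ler0n /=; apply: (@le_trans _ _ N%:R).
    by rewrite ler_nat -ltnS.
  by rewrite truncn_le // (le_trans ler01).
(* Truncation rounds down, so the mean label stays below [opt]. *)
rewrite -lee_fin -label_mass_integral //; last exact: measurable_sample_label.
rewrite /opt costE //; apply: ge0_le_integral_nonmeasurable => x.
  by rewrite lee_fin.
by rewrite lee_fin label_le_rad.
Qed.

Lemma typical_cost (xs : 'I_m -> I * S) (C : 'I_k -> S) :
  typ [ffun j => sample_label (xs j)] ->
  \sum_j rad C (xs j).2 <= \sum_j rad Cstar (xs j).2 + 1 ->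
  cost d k_gt0 C D <= (17 + 11 * kappa) * opt.
Proof.
move=> typv erm; have [d0 _ dsym dtri] := metric_d; have W1 := width_ge1.
have W0 : 0 < width d by exact: lt_le_trans W1.
pose a i := rad C (Cstar i).
have a0W i : 0 <= a i <= width d by rewrite rad_ge0 dist_le_width.
have mopt : L0 <= m%:R * opt.
  have : 12 * k%:R * L * width d <= m%:R * opt by rewrite -ler_pdivlMr.
  apply: le_trans; have k1 : 1 <= k%:R :> R by rewrite ler1n.
  have L0' : 0 < L by exact: lt_le_trans L0L.
  apply: (le_trans L0L); rewrite -mulrA -[leLHS]mul1r ler_pM //.
  - exact: ltW.
  - lra.
  - by rewrite ler_peMr // ltW.
have m0 : 0 < m%:R :> R.
  by rewrite -(pmulr_lgt0 _ opt0) (lt_le_trans L00).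
(* This absorbs the slack [1] of the near-minimizer into a multiple of [m%:R * opt]. *)
have one : 1 <= kappa * (m%:R * opt).
  rewrite hkappa mulrDl mul1r; have : 1 <= L0^-1 * (m%:R * opt).
    by rewrite ler_pdivlMl // mulr1.
  have : 0 < m%:R * opt by exact: lt_le_trans mopt.
  lra.
(* Moving a point to its optimal center changes its distance to [C] by at most [rad Cstar]: [far] is
   integrated over [D], [near] is summed over the sample. *)
have far s : rad C s <= a (nearest d k k_gt0 Cstar s) + rad Cstar s.
  apply: le_trans (closest_le_add d k k_gt0 metric_d C
    (Cstar (nearest d k k_gt0 Cstar s)) s) _.
  by rewrite dist_nearest.
have near s : a (nearest d k k_gt0 Cstar s) <= rad C s + rad Cstar s.
  apply: le_trans (closest_le_add d k k_gt0 metric_d C s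
    (Cstar (nearest d k k_gt0 Cstar s))) _.
  by rewrite (dsym s) dist_nearest.
have := @typical_sum _ _ k m q fst _ _ _ _ W0 _ a typv a0W.
have /andP[sumg _] := typv.
set sa := \sum_x _; set sj := \sum_(j < m) a _ => hsa.
(* One factor [2] comes from counting the cost of [Cstar] twice, by [near] and by [erm]; the other
   from truncation. *)
have hsj : sj <= 4 * ((2 + kappa) * (m%:R * opt)) + 1.
  apply: (@le_trans _ _ (\sum_j (rad C (xs j).2 + rad Cstar (xs j).2))).
    by apply: ler_sum => j _; rewrite ffunE; exact: near.
  rewrite big_split /=.
  have : \sum_j rad Cstar (xs j).2 <= 2 * ((2 + kappa) * (m%:R * opt)).
    apply: (@le_trans _ _ (2 * \sum_j
        (([ffun j => sample_label (xs j)] : {ffun 'I_m -> _}) j).2%:R)).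
      by rewrite mulr_sumr; apply: ler_sum => j _; rewrite ffunE rad_le_label.
    by rewrite ler_pM2l // ltW.
  lra.
(* The coefficient is [2 * 4 * (2 + kappa) + kappa], plus [2 * kappa] for the doubled slack. *)
have hsa' : sa <= (16 + 11 * kappa) * opt.
  by rewrite -(ler_pM2l m0); lra.
suff : cost d k_gt0 C D <= sa + opt by lra.
rewrite -lee_fin EFinD /opt !costE //.
have sa_int : sa%:E = (\int[D]_x (a (sample_label x).1)%:E)%E.
  rewrite (label_mass_integral D _ sample_label measurable_sample_label
    (fun l => a l.1)) // => l.
  by have /andP[] := a0W l.1.
rewrite sa_int -ge0_integralD //; last first.
- by apply/measurable_EFinP; exact: measurable_closest_snd.
- by move=> x _; rewrite lee_fin; exact: d0.
- apply/measurable_EFinP.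
  exact: (measurable_label_fun _ sample_label measurable_sample_label
    (fun l => a l.1)).
- by move=> x _; rewrite lee_fin; exact: d0.
apply: ge0_le_integral_nonmeasurable => x; first by rewrite lee_fin; exact: d0.
by rewrite -EFinD lee_fin; exact: far.
Qed.

End learning.

(** The constant depends only on [delta0], through [kappa], and [learn] is fixed before the
    distribution is given: it sees nothing but the samples. *)
Theorem theorem3p5 (R : realType) (delta0 : R) (hdelta0 : 0 < delta0 < 1) :
  exists2 c : R, 0 < c &
  forall (dI dS : measure_display)
    (I : measurableType dI) (S : measurableType dS)
    (d : S -> S -> R) (sol : I -> S) (A : algorithm (I * S) S)
    (k : nat) (k_gt0 : (0 < k)%N) (delta : R) (m : nat),
    is_metric d ->
    min_distance_one d ->
    finite_width d ->
    (forall p : S, measurable_fun setT (d p)) ->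
    warm_start d sol A ->
    (forall p : S, measurable_fun setT (fun i : I => runtime R A (i, p))) ->
    0 < delta <= delta0 ->
    exists learn : ('I_m -> I * S) -> ('I_k -> S),
      (forall xs i, exists n,
          computes_in (round_robin A (learn xs)) i (sol i) n) /\
      forall (D : probability (I * S)%type R) (Cstar : 'I_k -> S),
        {ae D, forall x, x.2 = sol x.1} ->
        (forall C : 'I_k -> S, cost d k_gt0 Cstar D <= cost d k_gt0 C D) ->
        0 < cost d k_gt0 Cstar D ->
        12%:R * width d * k%:R * ln (1 / delta) / cost d k_gt0 Cstar D
          <= m%:R ->
        forall (dO : measure_display) (Omega : measurableType dO)
          (P : probability Omega R) (X : 'I_m -> {RV P >-> (I * S)%type}),
          iid_samples D X ->
          exists E : set Omega,
            [/\ measurable E,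
                ((1 - delta)%:E <= P E)%E
              & forall omega, E omega ->
                  (\int[D]_x runtime R
                     (round_robin A (learn (fun j => X j omega))) x.1
                   <= (c * k%:R * cost d k_gt0 Cstar D)%:E)%E].
Proof.
move: hdelta0 => /andP[d00 d01].
pose L0 : R := ln (1 / delta0); pose kappa := 1 + L0^-1.
have L00 : 0 < L0 by rewrite ln_gt0 // ltr_pdivlMr // mul1r.
exists (17 + 11 * kappa).
  by rewrite addr_gt0 // mulr_gt0 // addr_gt0 // invr_gt0.
move=> dI dS I S d sol A k k_gt0 delta m metric_d min1 width_d md warm _.
move=> /andP[del0 deld].
have [nonneg _ _ _] := metric_d.
have [_ [s0 _]] := min1.
pose rad C s := d (@closest R S d k k_gt0 C s) s.
have /choice[learn ermP] : forall xs : 'I_m -> I * S, exists C : 'I_k -> S,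
    forall C', \sum_j rad C (xs j).2 <= \sum_j rad C' (xs j).2 + 1.
  move=> xs; apply: (near_minimizer _ (fun=> s0)) => C.
  by apply: sumr_ge0 => j _; exact: nonneg.
exists learn; split=> [xs i|D Cstar ae_sol _ opt0 hm dO Omega P X iidX].
  apply: round_robin_computes => // j.
  by have [n hn _] := warm i (learn xs j); exists n.
have W0 : 0 < width d by exact: lt_le_trans (width_ge1 d min1 width_d).
have L0L : L0 <= ln (1 / delta).
  by rewrite ler_ln ?posrE ?divr_gt0 // !div1r lef_pV2 // posrE.
have {}hm : 12 * k%:R * ln (1 / delta) <=
    m%:R * cost d k_gt0 Cstar D / width d.
  move: hm; rewrite ler_pdivrMr // ler_pdivlMr //; apply: le_trans.
  by rewrite le_eqVlt; apply/orP; left; apply/eqP; ring.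
have mlab := measurable_sample_label d k k_gt0 metric_d width_d md Cstar (I := I).
set phi := sample_label d k k_gt0 Cstar in mlab.
pose typ := typical (label_mass D _ phi) fst (fun l => l.2%:R) (width d)
  (cost d k_gt0 Cstar D) kappa (m := m).
(* The good event is typicality of the sample labels, measurable since it depends on finitely many
   labels. *)
exists [set w | typ [ffun j => phi (X j w)]]; split.
- exact: measurable_label_event.
- rewrite (label_event_prob D _ phi mlab P m X iidX) lee_fin.
  have -> : delta = expR (- ln (1 / delta)).
    by rewrite expRN lnK ?posrE ?divr_gt0 // div1r invrK.
  exact: (sample_typical_prob d k k_gt0 metric_d min1 width_d md Cstar D m
    kappa _ L0).
move=> w typw; apply: le_trans.
  exact: (expected_runtime_le d sol A k k_gt0 metric_d width_d md warm).
rewrite lee_fin -mulrA mulrCA ler_pM2l ?ltr0n //.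
exact: (typical_cost d k k_gt0 metric_d min1 width_d md Cstar D m
  kappa _ L0 opt0 L00 L0L hm erefl (fun j => X j w) _ typw (ermP _ _)).
Qed.
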